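(* Suppose $k_{0},k_{1}$ are natural numbers. There is a total $(k_{0}{+}1)$-ary recursive function $\textsf{s}_{k_{1}}^{k_{0}}(z,x_{1},\ldots,x_{k_{0}})$ such that for all numbers $j,i_{1},\ldots,i_{k_{0}}$ the following equality holds: \[\mathcal{U}^{[i,\jmath][k_{0}+k_{1}]}_{j}(i_{1},\ldots,i_{k_{0}},y_{1},\ldots,y_{k_{1}}) =_{\mathbb{VPC}} \mathcal{U}^{[i,\jmath][k_{1}]}_{\textsf{s}_{k_{1}}^{k_{0}}(j,i_{1},\ldots,i_{k_{0}})}(y_{1},\ldots,y_{k_{1}}).\]
   Context: In the value-passing calculus $\mathbb{VPC}$, a $k$-ary parametric definition $D(z_{1},\ldots,z_{k})=T$ is of type $[i,\jmath]$ if $i$ is the number of local names of $T$ and $\jmath$ is the list of global names of $T$. For numbers $i_1,\ldots,i_j$ ($j\le k$), $D(i_1,\ldots,i_j,z_{j+1},\ldots,z_k)$ denotes the $(k-j)$-ary definition with body $T\{i_1/z_1,\ldots,i_j/z_j\}$. Two $k$-ary parametric definitions $D_0,D_1$ are equal ($=_{\mathbb{VPC}}$) if $D_0(i_1,\ldots,i_k)=_{\mathbb{VPC}}D_1(i_1,\ldots,i_k)$ for all numbers $i_1,\ldots,i_k$, where $=_{\mathbb{VPC}}$ is the absolute equality. The $k$-ary parametric definitions of type $[i,\jmath]$ are Gödel-numbered, and $\mathcal{U}^{[i,\jmath][k]}_{z}(z_{1},\ldots,z_{k})$ is a universal parametric definition for them: for each number $j$ that is the index of a $k$-ary parametric definition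 $D(z_1,\ldots,z_k)$ of type $[i,\jmath]$, $\mathcal{U}^{[i,\jmath][k]}_{j}(z_{1},\ldots,z_{k}) =_{\mathbb{VPC}} D(z_{1},\ldots,z_{k})$. *)

(* Defs.v *)
From Stdlib Require Import Relations.
From mathcomp Require Import all_boot zify.

Set Implicit Arguments.
Unset Strict Implicit.
Unset Printing Implicit Defensive.

(* Names and numeric variables are two separate countable sorts. *)
Definition name := nat.
Definition var := nat.

Inductive nexp : Type :=
| Var of var
| Num of nat
| Suc of nexp
| Add of nexp & nexp
| Mul of nexp & nexp.

Inductive bexp : Type :=
| Eq of nexp & nexp
| Lt of nexp & nexp
| Neg of bexp
| And of bexp & bexp.

(* 0 | a(x).T | a^(t).T | T|T | (c)T | if phi then T | !a(x).T | !a^(t).T,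
   where a^ is the co-name of a.  [Inp a x T] and [RInp a x T] bind the numeric
   variable x in T; [Nu c T] binds the name c in T. *)
Inductive term : Type :=
| Nil
| Inp of name & var & term
| Out of name & nexp & term
| Par of term & term
| Nu of name & term
| If of bexp & term
| RInp of name & var & term
| ROut of name & nexp & term.

Fixpoint nfv (t : nexp) : seq var :=
  match t with
  | Var x => [:: x]
  | Num _ => [::]
  | Suc t => nfv t
  | Add t u | Mul t u => nfv t ++ nfv u
  end.

Fixpoint bfv (b : bexp) : seq var :=
  match b with
  | Eq t u | Lt t u => nfv t ++ nfv u
  | Neg b => bfv b
  | And b c => bfv b ++ bfv c
  end.

Fixpoint fv (T : term) : seq var :=
  match T with
  | Nil => [::]
  | Inp _ x T | RInp _ x T => [seq y <- fv T | y != x]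
  | Out _ t T | ROut _ t T => nfv t ++ fv T
  | Par T1 T2 => fv T1 ++ fv T2
  | Nu _ T => fv T
  | If b T => bfv b ++ fv T
  end.

(* A process is a term without free numeric variables. *)
Definition process (T : term) : Prop := fv T = [::].

Fixpoint global_names (T : term) : seq name :=
  match T with
  | Nil => [::]
  | Inp a _ T | Out a _ T | RInp a _ T | ROut a _ T => a :: global_names T
  | Par T1 T2 => global_names T1 ++ global_names T2
  | Nu c T => [seq a <- global_names T | a != c]
  | If _ T => global_names T
  end.

(* Counts the localization operators.  This is the number of local names under
   the usual convention that distinct binders bind distinct names; unlike the
   number of distinct bound identifiers, it is invariant under
   alpha-conversion. *)
Fixpoint local_count (T : term) : nat :=
  match T with
  | Nil => 0
  | Inp _ _ T | Out _ _ T | RInp _ _ T | ROut _ _ T | If _ T => local_count T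
  | Par T1 T2 => local_count T1 + local_count T2
  | Nu _ T => (local_count T).+1
  end.

(* Substitution {n/x} of a number for a variable; numbers are closed, so no
   capture can occur. *)
Fixpoint nsubst (x : var) (n : nat) (t : nexp) : nexp :=
  match t with
  | Var y => if y == x then Num n else Var y
  | Num m => Num m
  | Suc t => Suc (nsubst x n t)
  | Add t u => Add (nsubst x n t) (nsubst x n u)
  | Mul t u => Mul (nsubst x n t) (nsubst x n u)
  end.

Fixpoint bsubst (x : var) (n : nat) (b : bexp) : bexp :=
  match b with
  | Eq t u => Eq (nsubst x n t) (nsubst x n u)
  | Lt t u => Lt (nsubst x n t) (nsubst x n u)
  | Neg b => Neg (bsubst x n b)
  | And b c => And (bsubst x n b) (bsubst x n c)
  end.

Fixpoint subst (x : var) (n : nat) (T : term) : term :=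
  match T with
  | Nil => Nil
  | Inp a y T => Inp a y (if y == x then T else subst x n T)
  | Out a t T => Out a (nsubst x n t) (subst x n T)
  | Par T1 T2 => Par (subst x n T1) (subst x n T2)
  | Nu c T => Nu c (subst x n T)
  | If b T => If (bsubst x n b) (subst x n T)
  | RInp a y T => RInp a y (if y == x then T else subst x n T)
  | ROut a t T => ROut a (nsubst x n t) (subst x n T)
  end.

(* Meaningful on closed expressions only: the value at a variable is junk, and
   is never used in the transitions of a process. *)
Fixpoint neval (t : nexp) : nat :=
  match t with
  | Var _ => 0
  | Num n => n
  | Suc t => (neval t).+1
  | Add t u => neval t + neval u
  | Mul t u => neval t * neval u
  end.

Fixpoint beval (b : bexp) : bool :=
  match b with
  | Eq t u => neval t == neval u
  | Lt t u => neval t < neval u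
  | Neg b => ~~ beval b
  | And b c => beval b && beval c
  end.

Inductive label : Type :=
| Recv of name & nat
| Send of name & nat
| Tau.

Definition mentions (c : name) (l : label) : bool :=
  match l with
  | Recv a _ | Send a _ => a == c
  | Tau => false
  end.

Inductive step : term -> label -> term -> Prop :=
| step_inp a x n T : step (Inp a x T) (Recv a n) (subst x n T)
| step_out a t T : step (Out a t T) (Send a (neval t)) T
| step_parl l S S' T : step S l S' -> step (Par S T) l (Par S' T)
| step_parr l S T T' : step T l T' -> step (Par S T) l (Par S T')
| step_coml a n S S' T T' :
    step S (Recv a n) S' -> step T (Send a n) T' ->
    step (Par S T) Tau (Par S' T')
| step_comr a n S S' T T' :
    step S (Send a n) S' -> step T (Recv a n) T' ->
    step (Par S T) Tau (Par S' T')
| step_nu l c T T' :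
    step T l T' -> ~~ mentions c l -> step (Nu c T) l (Nu c T')
| step_if l b T T' : beval b -> step T l T' -> step (If b T) l T'
| step_rinp a x n T :
    step (RInp a x T) (Recv a n) (Par (subst x n T) (RInp a x T))
| step_rout a t T :
    step (ROut a t T) (Send a (neval t)) (Par T (ROut a t T)).

Definition tau (P Q : term) : Prop := step P Tau Q.
Definition taus : term -> term -> Prop := clos_refl_trans_1n _ tau.
Definition taus1 : term -> term -> Prop := clos_trans_1n _ tau.

Definition observable (P : term) : Prop :=
  exists P' P'' l, [/\ taus P P', l <> Tau & step P' l P''].

Definition process_relation (R : relation term) : Prop :=
  forall P Q, R P Q -> process P /\ process Q.

Definition reflexive_on_processes (R : relation term) : Prop :=
  forall P, process P -> R P P.

Definition equipollent (R : relation term) : Prop :=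
  forall P Q, R P Q -> (observable P <-> observable Q).

Definition extensional (R : relation term) : Prop :=
  (forall M N P Q, R M N -> R P Q -> R (Par M P) (Par N Q)) /\
  (forall c P Q, R P Q -> R (Nu c P) (Nu c Q)).

(* Branching style: an internal step P -> P' is simulated either by a
   state-preserving sequence of steps reaching a process related to both P and
   P', or by such a sequence followed by one matching step. *)
Definition simulation (R : relation term) : Prop :=
  forall P Q P', R P Q -> tau P P' ->
    (exists Q', [/\ taus Q Q', R P Q' & R P' Q']) \/
    (exists Q'' Q', [/\ taus Q Q'', R P Q'', tau Q'' Q' & R P' Q']).

Definition bisimulation (R : relation term) : Prop :=
  simulation R /\ simulation (fun P Q => R Q P).

Definition divergence_preserving (R : relation term) : Prop :=
  forall (P : nat -> term) Q,
    R (P 0) Q -> (forall m, tau (P m) (P m.+1)) ->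
    exists m Q', [/\ 0 < m, taus1 Q Q' & R (P m) Q'].

Definition codivergent (R : relation term) : Prop :=
  divergence_preserving R /\ divergence_preserving (fun P Q => R Q P).

(* The largest reflexive, equipollent, extensional, codivergent bisimulation
   on processes. *)
Definition abs_eq (P Q : term) : Prop :=
  exists R : relation term,
    [/\ [/\ process_relation R & reflexive_on_processes R],
        [/\ equipollent R, extensional R, codivergent R & bisimulation R]
      & R P Q].

(* [PDef zs T] is D(z_1,...,z_k) = T with zs = [:: z_1; ...; z_k]. *)
Record pdef : Type := PDef { params : seq var; body : term }.

Definition kary (k : nat) (D : pdef) : Prop :=
  [/\ size (params D) = k, uniq (params D) & {subset fv (body D) <= params D}].

Definition has_type (i : nat) (js : seq name) (D : pdef) : Prop :=
  local_count (body D) = i /\ global_names (body D) =i js.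

(* D(i_1,...,i_j,z_{j+1},...,z_k) *)
Fixpoint inst_rec (zs : seq var) (T : term) (ns : seq nat) : pdef :=
  match zs, ns with
  | z :: zs, n :: ns => inst_rec zs (subst z n T) ns
  | _, _ => PDef zs T
  end.

Definition inst (D : pdef) (ns : seq nat) : pdef :=
  inst_rec (params D) (body D) ns.

Definition pdef_eq (k : nat) (D0 D1 : pdef) : Prop :=
  forall ns : k.-tuple nat, abs_eq (body (inst D0 ns)) (body (inst D1 ns)).

Definition tri (w : nat) : nat := (w * w.+1)./2.
Definition npair (m n : nat) : nat := tri (m + n) + m.

Fixpoint ncode (t : nexp) : nat :=
  match t with
  | Var x => 5 * x
  | Num n => 5 * n + 1
  | Suc t => 5 * ncode t + 2
  | Add t u => 5 * npair (ncode t) (ncode u) + 3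
  | Mul t u => 5 * npair (ncode t) (ncode u) + 4
  end.

Fixpoint bcode (b : bexp) : nat :=
  match b with
  | Eq t u => 4 * npair (ncode t) (ncode u)
  | Lt t u => 4 * npair (ncode t) (ncode u) + 1
  | Neg b => 4 * bcode b + 2
  | And b c => 4 * npair (bcode b) (bcode c) + 3
  end.

Fixpoint tcode (T : term) : nat :=
  match T with
  | Nil => 0
  | Inp a x T => 7 * npair a (npair x (tcode T)) + 1
  | Out a t T => 7 * npair a (npair (ncode t) (tcode T)) + 2
  | Par T1 T2 => 7 * npair (tcode T1) (tcode T2) + 3
  | Nu c T => 7 * npair c (tcode T) + 4
  | If b T => 7 * npair (bcode b) (tcode T) + 5
  | RInp a x T => 7 * npair a (npair x (tcode T)) + 6
  | ROut a t T => 7 * npair a (npair (ncode t) (tcode T)) + 7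
  end.

Fixpoint scode (s : seq nat) : nat :=
  if s is x :: s' then (npair x (scode s')).+1 else 0.

Definition dcode (D : pdef) : nat := npair (scode (params D)) (tcode (body D)).

Definition inert (i : nat) (js : seq name) (k : nat) : pdef :=
  PDef (iota 0 k)
       (Par (iter i (Nu 0) Nil)
            (If (Lt (Num 0) (Num 0))
                (foldr (fun a T => Out a (Num 0) T) Nil js))).

(* j is the index of the k-ary definition D of type [i,js].  As usual, a number
   that is not the code of such a definition is read as an index of a fixed
   inert one, so that every number is an index ([has_index_total]). *)
Definition has_index (i : nat) (js : seq name) (k j : nat) (D : pdef) : Prop :=
  [/\ kary k D, has_type i js D & dcode D = j] \/
  (forall D', kary k D' -> has_type i js D' -> dcode D' <> j) /\
  D = inert i js k.

(* U_z(z_1,...,z_k) is a definition with the parameters z, z_1, ..., z_k. *)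
Definition universal (i : nat) (js : seq name) (k : nat) (U : pdef) : Prop :=
  kary k.+1 U /\
  forall j D, has_index i js k j D -> pdef_eq k (inst U [:: j]) D.

(* The general recursive functions: minimization is applied to regular functions
   only, which yields exactly the total functions among the partial recursive
   ones. *)
Inductive recursive : forall n : nat, (n.-tuple nat -> nat) -> Prop :=
| rec_zero n : recursive (fun _ : n.-tuple nat => 0)
| rec_succ : recursive (fun v : 1.-tuple nat => (thead v).+1)
| rec_proj n (i : 'I_n) : recursive (fun v : n.-tuple nat => tnth v i)
| rec_comp n m (f : m.-tuple nat -> nat) (g : 'I_m -> n.-tuple nat -> nat) :
    recursive f -> (forall i, recursive (g i)) ->
    recursive (fun v : n.-tuple nat => f [tuple g i v | i < m])
| rec_prim n (f : n.-tuple nat -> nat) (g : n.+2.-tuple nat -> nat)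
    (h : n.+1.-tuple nat -> nat) :
    recursive f -> recursive g ->
    (forall v : n.-tuple nat, h [tuple of 0 :: v] = f v) ->
    (forall y (v : n.-tuple nat),
        h [tuple of y.+1 :: v] = g [tuple of y :: h [tuple of y :: v] :: v]) ->
    recursive h
| rec_min n (f : n.+1.-tuple nat -> nat) (h : n.-tuple nat -> nat) :
    recursive f ->
    (forall v : n.-tuple nat, f [tuple of h v :: v] = 0) ->
    (forall (v : n.-tuple nat) y, y < h v -> f [tuple of y :: v] <> 0) ->
    recursive h
| rec_ext n (f h : n.-tuple nat -> nat) : recursive f -> f =1 h -> recursive h.

Lemma triS w : tri w.+1 = tri w + w.+1.
Proof.
rewrite /tri; have -> : w.+1 * w.+2 = w * w.+1 + w.+1 * 2 by nia.
by rewrite halfD oddM /= muln2 odd_double andbF doubleK.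
Qed.

Lemma tri_le w w' : w <= w' -> tri w <= tri w'.
Proof. by rewrite /tri => h; apply: half_leq; nia. Qed.

Lemma npair_inj m n m' n' : npair m n = npair m' n' -> m = m' /\ n = n'.
Proof.
rewrite /npair => h; have := triS (m + n); have := triS (m' + n') => h1 h2.
have [lt|lt|e] := ltngtP (m + n) (m' + n').
- by have := tri_le lt; lia.
- by have := tri_le lt; lia.
- by rewrite e in h; lia.
Qed.

Lemma npair_surj p : exists m n, p = npair m n.
Proof.
elim: p => [|p [m [[|n] ->]]]; first by exists 0, 0.
- exists 0, m.+1; rewrite /npair add0n addn0 triS; lia.
- exists m.+1, n; rewrite /npair addnS addSn; lia.
Qed.

Lemma tri_ge w : w <= tri w.
Proof. by elim: w => // w IH; rewrite triS; lia. Qed.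

Lemma npair_ge m n : m <= npair m n /\ n <= npair m n.
Proof. by rewrite /npair; have := tri_ge (m + n); lia. Qed.

Lemma ncode_inj : injective ncode.
Proof.
elim=> [x|n|t IH|t IHt u IHu|t IHt u IHu] [y|m|t'|t' u'|t' u'] /= e; try lia.
- by congr Var; lia.
- by congr Num; lia.
- by congr Suc; apply: IH; lia.
- have /npair_inj[/IHt-> /IHu->] //: npair (ncode t) (ncode u) = npair (ncode t') (ncode u') by lia.
- have /npair_inj[/IHt-> /IHu->] //: npair (ncode t) (ncode u) = npair (ncode t') (ncode u') by lia.
Qed.

Lemma bcode_inj : injective bcode.
Proof.
elim=> [t u|t u|b IH|b IHb c IHc] [t' u'|t' u'|b'|b' c'] /= e; try lia.
- have /npair_inj[/ncode_inj-> /ncode_inj->] //: npair (ncode t) (ncode u) = npair (ncode t') (ncode u') by lia.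
- have /npair_inj[/ncode_inj-> /ncode_inj->] //: npair (ncode t) (ncode u) = npair (ncode t') (ncode u') by lia.
- by congr Neg; apply: IH; lia.
- have /npair_inj[/IHb-> /IHc->] //: npair (bcode b) (bcode c) = npair (bcode b') (bcode c') by lia.
Qed.

Lemma tcode_inj : injective tcode.
Proof.
have E k a b r : k.+1 * a + r = k.+1 * b + r -> a = b by nia.
elim=> [|a x T IH|a t T IH|S IHS T IHT|c T IH|b T IH|a x T IH|a t T IH]
  [|a' x' T'|a' t' T'|S' T'|c' T'|b' T'|a' x' T'|a' t' T'] //= e; try lia.
- by move/E/npair_inj: e => [-> /npair_inj[-> /IH->]].
- by move/E/npair_inj: e => [-> /npair_inj[/ncode_inj-> /IH->]].
- by move/E/npair_inj: e => [/IHS-> /IHT->].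
- by move/E/npair_inj: e => [-> /IH->].
- by move/E/npair_inj: e => [/bcode_inj-> /IH->].
- by move/E/npair_inj: e => [-> /npair_inj[-> /IH->]].
- by move/E/npair_inj: e => [-> /npair_inj[/ncode_inj-> /IH->]].
Qed.

Lemma scode_inj : injective scode.
Proof. by elim=> [|x s IH] [|y s'] //= [] /npair_inj[-> /IH->]. Qed.

Lemma dcode_inj : injective dcode.
Proof.
by move=> [zs T] [zs' T'] /npair_inj[/= /scode_inj-> /tcode_inj->].
Qed.

Lemma ncode_surj n : exists t, ncode t = n.
Proof.
elim/ltn_ind: n => n IH; have := divn_eq n 5; have := ltn_pmod n (isT : 0 < 5).
move: (n %/ 5) (n %% 5) => q [|[|[|[|[|r]]]]] // _ e.
- by exists (Var q) => /=; lia.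
- by exists (Num q) => /=; lia.
- by have [|t et] := IH q; [lia | exists (Suc t) => /=; lia].
- have [a [b eq]] := npair_surj q; have [la lb] := npair_ge a b.
  have [|t et] := IH a; first lia; have [|u eu] := IH b; first lia.
  by exists (Add t u) => /=; rewrite et eu; lia.
- have [a [b eq]] := npair_surj q; have [la lb] := npair_ge a b.
  have [|t et] := IH a; first lia; have [|u eu] := IH b; first lia.
  by exists (Mul t u) => /=; rewrite et eu; lia.
Qed.

Lemma bcode_surj n : exists b, bcode b = n.
Proof.
elim/ltn_ind: n => n IH; have := divn_eq n 4; have := ltn_pmod n (isT : 0 < 4).
move: (n %/ 4) (n %% 4) => q [|[|[|[|r]]]] // _ e;
  have [a [b eq]] := npair_surj q; have [la lb] := npair_ge a b.
- have [[t et] [u eu]] := (ncode_surj a, ncode_surj b).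
  by exists (Eq t u) => /=; rewrite et eu; lia.
- have [[t et] [u eu]] := (ncode_surj a, ncode_surj b).
  by exists (Lt t u) => /=; rewrite et eu; lia.
- by have [|c ec] := IH q; [lia | exists (Neg c) => /=; lia].
- have [|c ec] := IH a; first lia; have [|d ed] := IH b; first lia.
  by exists (And c d) => /=; rewrite ec ed; lia.
Qed.

Lemma tcode_surj n : exists T, tcode T = n.
Proof.
elim/ltn_ind: n => -[_|n IH]; first by exists Nil.
have := divn_eq n 7; have := ltn_pmod n (isT : 0 < 7).
move: (n %/ 7) (n %% 7) => q r lr e.
have [a [b eq]] := npair_surj q; have [la lb] := npair_ge a b.
have [c [d eb]] := npair_surj b; have [lc ld] := npair_ge c d.
have [|S eS] := IH a; first lia; have [|T eT] := IH b; first lia.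
have [|V eV] := IH d; first lia.
have [[t et] [f ef]] := (ncode_surj c, bcode_surj a).
case: r lr e => [|[|[|[|[|[|[|r]]]]]]] // _ e.
- by exists (Inp a c V) => /=; rewrite eV -eb; lia.
- by exists (Out a t V) => /=; rewrite eV et -eb; lia.
- by exists (Par S T) => /=; rewrite eS eT; lia.
- by exists (Nu a T) => /=; rewrite eT; lia.
- by exists (If f T) => /=; rewrite ef eT; lia.
- by exists (RInp a c V) => /=; rewrite eV -eb; lia.
- by exists (ROut a t V) => /=; rewrite eV et -eb; lia.
Qed.

Lemma scode_surj n : exists s, scode s = n.
Proof.
elim/ltn_ind: n => -[_|n IH]; first by exists [::].
have [a [b eq]] := npair_surj n; have [la lb] := npair_ge a b.
by have [|s es] := IH b; [lia | exists (a :: s) => /=; rewrite es -eq].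
Qed.

Lemma dcode_surj n : exists D, dcode D = n.
Proof.
have [a [b ->]] := npair_surj n.
have [[zs ezs] [T eT]] := (scode_surj a, tcode_surj b).
by exists (PDef zs T); rewrite /dcode ezs eT.
Qed.

Lemma inert_kary i js k : kary k (inert i js k).
Proof.
have e T j : fv (iter j (Nu 0) T) = fv T by elim: j.
split=> /=; rewrite ?size_iota ?iota_uniq // e /= => x.
by elim: js.
Qed.

Lemma inert_has_type i js k : has_type i js (inert i js k).
Proof.
have e1 : local_count (iter i (Nu 0) Nil) = i by elim: i => //= i ->.
have e2 : global_names (iter i (Nu 0) Nil) = [::] by elim: {e1} i => //= i ->.
have e3 : local_count (foldr (fun a T => Out a (Num 0) T) Nil js) = 0.
  by elim: js.
have e4 : global_names (foldr (fun a T => Out a (Num 0) T) Nil js) = js.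
  by elim: {e3} js => //= b js ->.
by split=> [|a] /=; rewrite ?e1 ?e2 ?e3 ?e4 ?addn0.
Qed.

Lemma has_index_typed i js k j D :
  has_index i js k j D -> kary k D /\ has_type i js D.
Proof.
case=> [[] //|[_ ->]].
by split; [apply: inert_kary | apply: inert_has_type].
Qed.

Lemma has_index_uniq i js k j D D' :
  has_index i js k j D -> has_index i js k j D' -> D = D'.
Proof.
case=> [[kD tD <-]|[nD ->]] [[kD' tD' e]|[nD' ->]] //.
- by apply: dcode_inj.
- by case: (nD' _ kD tD).
- by case: (nD _ kD' tD').
Qed.

Lemma has_index_total i js k j : exists D, has_index i js k j D.
Proof.
have [D eD] := dcode_surj j.
have [ok|nok] : (kary k D /\ has_type i js D) \/ ~ (kary k D /\ has_type i js D).
- have [/eqP e1|/eqP n1] := boolP (size (params D) == k); last by right=> -[[]].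
  have [e2|/negP n2] := boolP (uniq (params D)); last by right=> -[[]].
  have [/allP e3|/negP n3] := boolP (all [in params D] (fv (body D)));
    last by right=> -[[_ _ /allP]].
  have [/eqP e4|/eqP n4] := boolP (local_count (body D) == i);
    last by right=> -[_ []].
  have [/andP[/allP e5 /allP e6]|n5] := boolP (all [in js] (global_names (body D))
                        && all [in global_names (body D)] js).
    by left; split; split=> // a; apply/idP/idP; [exact: e5 | exact: e6].
  right=> -[_ [_ e]]; case/negP: n5.
  by apply/andP; split; apply/allP => a; rewrite /= e.
- by exists D; left; case: ok.
- exists (inert i js k); right; split=> // D' kD' tD' eD'; apply: nok.
  by have -> : D = D' by apply: dcode_inj; rewrite eD.
Qed.

(* Main.v *)
From Stdlib Require Import Relations IndefiniteDescription.
Require Import Defs.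
From mathcomp Require Import all_boot zify.

Set Implicit Arguments.
Unset Strict Implicit.
Unset Printing Implicit Defensive.

(* Every number j indexes exactly one typed definition D, and j |-> code of
   D(i_1,...,i_k0,y_1,...,y_k1) is the required function: both universal
   definitions are then equal to this instance of D.  The rest is that absolute
   equality is transitive, because the relations that define it compose, and
   that decoding, type checking and substitution are recursive on codes, by
   course-of-values recursion. *)

(** * Symmetry and transitivity of absolute equality *)

Lemma abs_eq_sym P Q : abs_eq P Q -> abs_eq Q P.
Proof.
move=> [R [[pR rR] [eR [xR yR] [dR dR'] [sR sR']] RPQ]].
exists (fun P Q => R Q P); split=> //; split.
- by move=> P1 Q1 /pR[].
- by move=> P1; apply: rR.
- by move=> P1 Q1 /eR[].
- by split=> [M N P1 Q1|c P1 Q1]; [apply: xR | apply: yR].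
- by split.
- by split.
Qed.

Lemma taus_trans P Q S : taus P Q -> taus Q S -> taus P S.
Proof.
by elim=> // P1 P2 P3 st _ IH /IH; apply: Relation_Operators.rt1n_trans.
Qed.

Lemma taus_taus1 P Q S : taus P Q -> taus1 Q S -> taus1 P S.
Proof.
by elim=> // P1 P2 P3 st _ IH /IH; apply: Relation_Operators.t1n_trans.
Qed.

Lemma taus1E P Q : taus1 P Q <-> exists2 P', tau P P' & taus P' Q.
Proof.
split=> [|[P' st ts]].
  elim=> [P1 P2 st|P1 P2 P3 st _ [P4 st' ts]].
    by exists P2 => //; apply: rt1n_refl.
  by exists P2 => //; apply: Relation_Operators.rt1n_trans st' ts.
elim: ts P st => [P1|P1 P2 P3 st' _ IH] P st; first exact: t1n_step.
by apply: Relation_Operators.t1n_trans st (IH _ st').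
Qed.

Lemma taus1_taus P Q S : taus1 P Q -> taus Q S -> taus1 P S.
Proof.
move=> /taus1E[P' st ts] ts'; apply/taus1E.
by exists P' => //; apply: taus_trans ts'.
Qed.

(** By induction on the path: either form of the answer to one internal step ends in a process
    related to its target, so the answers can be concatenated. *)
Lemma simulation_taus R P Q P' :
  simulation R -> R P Q -> taus P P' -> exists2 Q', taus Q Q' & R P' Q'.
Proof.
move=> sR RPQ ts; elim: ts Q RPQ => [P1|P1 P2 P3 st _ IH] Q RPQ.
  by exists Q => //; constructor.
have [[Q1 [tQ _ /IH[Q2 t12 R2]]]|[Q1 [Q2 [tQ _ st1 /IH[Q3 t23 R3]]]]] :=
  sR _ _ _ RPQ st.
  by exists Q2 => //; apply: taus_trans t12.
by exists Q3 => //; apply: taus_trans tQ _; apply: Relation_Operators.rt1n_trans st1 t23.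
Qed.

Definition rel_comp (R S : relation term) : relation term :=
  fun P Q => exists2 X, R P X & S X Q.

(** The answer of the middle process [X] is replayed by [Q] in two stages: its state-preserving
    prefix by [simulation_taus], and its last step, if there is one, by the branching condition of
    [S]. The second stage starts from a process related to the end of the prefix, so state
    preservation survives. *)
Lemma simulation_comp R S :
  simulation R -> simulation S -> simulation (rel_comp R S).
Proof.
move=> sR sS P Q P' [X RPX SXQ] st.
have [[X' [tX RPX' RPX'']]|[X'' [X' [tX RPX'' st' RPX']]]] := sR _ _ _ RPX st.
  have [Q' tQ SXQ'] := simulation_taus sS SXQ tX.
  by left; exists Q'; split=> //; exists X'.
have [Q2 tQ SXQ2] := simulation_taus sS SXQ tX.
have [[Q' [tQ' S1 S2]]|[Q'' [Q' [tQ' S1 st2 S2]]]] := sS _ _ _ SXQ2 st'.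
  by left; exists Q'; split; [apply: taus_trans tQ' | exists X'' | exists X'].
right; exists Q'', Q'; split=> //; first exact: taus_trans tQ'.
  by exists X''.
by exists X'.
Qed.

(** Functional choice on the subtype of good elements gives a successor function, and its iterates
    form the sequence. It turns stepwise progress into an infinite run. *)
Lemma dependent_choice (A : Type) (good : A -> Prop) (next : relation A) x :
  good x -> (forall y, good y -> exists2 z, next y z & good z) ->
  exists f : nat -> A,
    [/\ f 0 = x, forall m, next (f m) (f m.+1) & forall m, good (f m)].
Proof.
move=> gx ex.
have [F HF] : exists F : {y | good y} -> {y | good y},
    forall y, next (sval y) (sval (F y)).
  apply: (functional_choice (fun y z => next (sval y) (sval z))) => -[y gy].
  by have [z nyz gz] := ex y gy; exists (exist _ z gz).
exists (fun m => sval (iter m F (exist _ x gx))).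
by split=> // m; case: (iter _ _ _).
Qed.

(* A diverging run of P yields one of the intermediate X.  The run of Q can only
   be compared with X in the middle of the answer to a step of P, so X first
   moves on to the end of that answer. *)
Lemma divergence_preserving_comp R S :
  simulation S -> divergence_preserving R -> divergence_preserving S ->
  divergence_preserving (rel_comp R S).
Proof.
move=> sS dR dS P Q [X RPX SXQ] run.
(* Divergence preservation is applied to the tail of the run that starts at [P m]. *)
have dRm m Y : R (P m) Y ->
    exists m' Y', [/\ 0 < m', taus1 Y Y' & R (P m') Y'].
  move=> RPY; have [| |m' [Y' [m'_gt0 tY RY']]] := dR (fun l => P (m + l)) Y.
  - by rewrite addn0.
  - by move=> l; rewrite addnS.
  - by exists (m + m'), Y'; split=> //; rewrite addn_gt0 m'_gt0 orbT.
(* The invariant of the intermediate run: [Y] can still reach a process related to some state of the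
   run of [P]. If the remaining path is empty, [dRm] supplies a nonempty one, so a next step always
   exists. *)
pose good Y := exists m Y', taus Y Y' /\ R (P m) Y'.
have [||f [f0 frun fgood]] := @dependent_choice _ good tau X.
- by exists 0, X; split=> //; constructor.
- move=> Y [m [Y' [tY]]]; case: tY => [|Y1 Y2 st tY'] RPY.
    have [m' [Y'' [_ /taus1E[Y1 st tY'] RY'']]] := dRm _ _ RPY.
    by exists Y1 => //; exists m', Y''.
  by exists Y1 => //; exists m, Y2.
rewrite -f0 in SXQ; have [l [Q' [_ tQ SXQ']]] := dS _ _ SXQ frun.
(* The index [m] obtained from [fgood] may be 0; one more use of [dRm] makes it positive. *)
have [m [Y [tY /dRm[m' [Y' [m'_gt0 tY' RY']]]]]] := fgood l.
have /taus1E[Y1 st1 tY1] := taus_taus1 tY tY'.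
have [Q'' tQ'' SQ''] :=
  simulation_taus sS SXQ' (Relation_Operators.rt1n_trans _ _ _ _ _ st1 tY1).
exists m', Q''; split=> //; first exact: taus1_taus tQ''.
by exists Y'.
Qed.

(** The composite of the two witnessing relations is again a reflexive, equipollent, extensional,
    codivergent bisimulation. *)
Lemma abs_eq_trans P Q S : abs_eq P Q -> abs_eq Q S -> abs_eq P S.
Proof.
move=> [R1 [[pR1 rR1] [eR1 [xR1 yR1] [dR1 dR1'] [sR1 sR1']] RPQ]].
move=> [R2 [[pR2 rR2] [eR2 [xR2 yR2] [dR2 dR2'] [sR2 sR2']] RQS]].
exists (rel_comp R1 R2); split; last by exists Q.
- split=> [P1 Q1 [X /pR1[pP _] /pR2[_ pQ]] //|P1 pP].
  by exists P1; [apply: rR1 | apply: rR2].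
split.
- by move=> P1 Q1 [X /eR1 e1 /eR2 e2]; rewrite e1.
- split=> [M N P1 Q1 [X r1 r2] [Y r1' r2']|c P1 Q1 [X r1 r2]].
    by exists (Par X Y); [apply: xR1 | apply: xR2].
  by exists (Nu c X); [apply: yR1 | apply: yR2].
- split; first exact: divergence_preserving_comp.
  (* The converse of a composite is the composite of the converses in reverse order, but only up to
     the order of the two conjuncts; hence the unpacking and repacking of the middle process, here
     and for the simulation. *)
  move=> P1 Q1 [X r1 r2] run.
  have [|m [Q' [m0 tQ [Y s1 s2]]]] :=
    divergence_preserving_comp sR1' dR2' dR1' _ run (Q := Q1); first by exists X.
  by exists m, Q'; split=> //; exists Y.
- split; first exact: simulation_comp.
  move=> P1 Q1 P1' [X r1 r2] st.
  have [|[Q' [tQ [Y a1 a2] [Z b1 b2]]]|[Q'' [Q' [tQ [Y a1 a2] st' [Z b1 b2]]]]] :=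
    simulation_comp sR2' sR1' (P := P1) (Q := Q1) _ st; first by exists X.
    by left; exists Q'; split=> //; [exists Y | exists Z].
  by right; exists Q'', Q'; split=> //; [exists Y | exists Z].
Qed.

(** * Instantiation and its effect on arity and type *)

Lemma inst_cat D ns ms : inst (inst D ns) ms = inst D (ns ++ ms).
Proof.
case: D => zs T; rewrite /inst /=.
by elim: ns zs T => [|n ns IH] [|z zs] T /=.
Qed.

Lemma nfv_nsubst x n t : nfv (nsubst x n t) = [seq y <- nfv t | y != x].
Proof.
elim: t => //= [y|t IHt u IHu|t IHt u IHu]; last 2 first.
- by rewrite IHt IHu filter_cat.
- by rewrite IHt IHu filter_cat.
by case: eqP.
Qed.

Lemma bfv_bsubst x n b : bfv (bsubst x n b) = [seq y <- bfv b | y != x].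
Proof.
by elim: b => //= [t u|t u|b IHb c IHc]; rewrite ?IHb ?IHc ?nfv_nsubst filter_cat.
Qed.

Lemma fv_subst x n T : fv (subst x n T) = [seq y <- fv T | y != x].
Proof.
elim: T => //= [a y T IH|a t T IH|S IHS T IHT|b T IH|a y T IH|a t T IH].
- case: eqP => [->|_]; first by rewrite filter_id.
  by rewrite IH -!filter_predI; apply: eq_filter => z /=; rewrite andbC.
- by rewrite IH nfv_nsubst filter_cat.
- by rewrite IHS IHT filter_cat.
- by rewrite IH bfv_bsubst filter_cat.
- case: eqP => [->|_]; first by rewrite filter_id.
  by rewrite IH -!filter_predI; apply: eq_filter => z /=; rewrite andbC.
- by rewrite IH nfv_nsubst filter_cat.
Qed.

Lemma global_names_subst x n T : global_names (subst x n T) = global_names T.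
Proof.
by elim: T => //= [a y T IH|a t T ->|S -> T ->|c T ->|a y T IH|a t T ->] //;
  case: eqP; rewrite ?IH.
Qed.

Lemma local_count_subst x n T : local_count (subst x n T) = local_count T.
Proof.
by elim: T => //= [a y T IH|S -> T ->|c T ->|a y T IH] //; case: eqP; rewrite ?IH.
Qed.

(** Substituting a closed number deletes its variable from the free ones, so those that are left lie
    among the remaining parameters. *)
Lemma inst_kary k0 k1 D (ns : k0.-tuple nat) :
  kary (k0 + k1) D -> kary k1 (inst D ns).
Proof.
case: D => zs T; case: ns => ns /= /eqP<- {k0}; rewrite /inst /=.
elim: ns zs T => [|n ns IH] [|z zs] T //= [/= e u s] //; apply: IH; split=> //=.
- by case: e.
- by case/andP: u.
- by move=> x; rewrite fv_subst mem_filter => /andP[/negPf xz /s]; rewrite inE xz.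
Qed.

Lemma inst_has_type i js D ns : has_type i js D -> has_type i js (inst D ns).
Proof.
case: D => zs T; rewrite /inst /=.
elim: ns zs T => [|n ns IH] [|z zs] T //= [e1 e2]; apply: IH.
by split; rewrite /= ?local_count_subst ?global_names_subst.
Qed.

(** * Closure properties of the recursive functions *)

(** Recursiveness is put as stability under plugging in recursive functions of any arity, so that
    proofs follow the shape of an expression and avoid tuples. *)
Definition recursive1 (f : nat -> nat) : Prop :=
  forall n (g : n.-tuple nat -> nat), recursive g -> recursive (fun v => f (g v)).

Definition recursive2 (f : nat -> nat -> nat) : Prop :=
  forall n (g1 g2 : n.-tuple nat -> nat), recursive g1 -> recursive g2 ->
    recursive (fun v => f (g1 v) (g2 v)).

Definition recursive3 (f : nat -> nat -> nat -> nat) : Prop :=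
  forall n (g1 g2 g3 : n.-tuple nat -> nat),
    recursive g1 -> recursive g2 -> recursive g3 ->
    recursive (fun v => f (g1 v) (g2 v) (g3 v)).

Lemma recursive1P (h : 1.-tuple nat -> nat) (f : nat -> nat) :
  recursive h -> (forall x, h [tuple x] = f x) -> recursive1 f.
Proof.
move=> rh e n g rg; have := rec_comp rh (fun=> rg).
move/rec_ext; apply=> v /=; rewrite -e; congr h.
by apply: eq_from_tnth => i; rewrite tnth_mktuple (ord1 i).
Qed.

Lemma recursive2P (h : 2.-tuple nat -> nat) (f : nat -> nat -> nat) :
  recursive h -> (forall x y, h [tuple x; y] = f x y) -> recursive2 f.
Proof.
move=> rh e n g1 g2 r1 r2.
have rg (i : 'I_2) : recursive (fun v => tnth [tuple g1; g2] i v).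
  by case: i => -[|[|//]] /= lt; rewrite (tnth_nth g1).
have := rec_comp rh rg.
move/rec_ext; apply=> v /=; rewrite -e; congr h.
apply: eq_from_tnth => i; rewrite tnth_mktuple.
by case: i => -[|[|//]] /= lt; rewrite (tnth_nth g1) (tnth_nth 0).
Qed.

Lemma recursive_const n c : recursive (fun _ : n.-tuple nat => c).
Proof.
elim: c => [|c IH]; first exact: rec_zero.
by have := @recursive1P _ S rec_succ (fun=> erefl) _ _ IH.
Qed.

Lemma recursiveS n (f : n.-tuple nat -> nat) :
  recursive f -> recursive (fun v => (f v).+1).
Proof. exact: (@recursive1P _ S rec_succ (fun=> erefl)). Qed.

Lemma recursive2_prim f g h :
  recursive1 f -> recursive3 g -> (forall p, h 0 p = f p) ->
  (forall y p, h y.+1 p = g y (h y p) p) -> recursive2 h.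
Proof.
move=> rf rg h0 hS.
pose h' (v : 2.-tuple nat) := h (tnth v ord0) (tnth v ord_max).
apply: (@recursive2P h') => [|x y]; last by rewrite /h' !(tnth_nth 0).
apply: (rec_prim (rf _ _ (rec_proj ord0))
          (rg _ _ _ _ (rec_proj ord0) (rec_proj (lift ord0 ord0))
             (rec_proj ord_max))).
  by move=> v; rewrite /h' (tnth_nth 0) h0 !(tnth_nth 0) /=; case: v => -[|? []].
move=> y v; rewrite /h' !(tnth_nth 0) /= hS.
by case: v => -[|? []].
Qed.

Lemma recursive1_min f h :
  recursive2 f -> (forall p, f (h p) p = 0) ->
  (forall p y, y < h p -> f y p <> 0) -> recursive1 h.
Proof.
move=> rf h0 hmin; apply: (@recursive1P (fun v => h (tnth v ord0))) => //.
apply: (rec_min (rf _ _ _ (rec_proj ord0) (rec_proj (lift ord0 ord0)))).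
  by move=> v; rewrite (tnth_nth 0) /= !(tnth_nth 0) /= h0.
by move=> v y; rewrite !(tnth_nth 0) /= => /hmin.
Qed.

Create HintDb recdb.
#[local] Hint Resolve recursive_const recursiveS : recdb.
(** Each hint strips the outermost operation of the function; [cbv zeta] expands local definitions
    so that the hints see the operations. *)
Ltac solve_rec :=
  repeat (match goal with
    | |- recursive1 _ => move=> ? ? ?
    | |- recursive2 _ => move=> ? ? ? ? ?
    | |- recursive3 _ => move=> ? ? ? ? ? ? ?
    end); cbv zeta; auto 60 with recdb nocore.

Lemma recursiveD : recursive2 addn.
Proof.
by apply: (@recursive2_prim id (fun y r p => r.+1)) => //; solve_rec.
Qed.
#[local] Hint Resolve recursiveD : recdb.

Lemma recursiveM : recursive2 muln.
Proof.
apply: (@recursive2_prim (fun=> 0) (fun y r p => p + r)) => //; solve_rec.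
Qed.
#[local] Hint Resolve recursiveM : recdb.

Lemma recursive_pred : recursive1 predn.
Proof.
suff r : recursive2 (fun y _ => y.-1) by move=> n g rg; exact: (r _ _ _ rg rg).
by apply: (@recursive2_prim (fun=> 0) (fun y r p => y)) => //; solve_rec.
Qed.
#[local] Hint Resolve recursive_pred : recdb.

Lemma recursiveB : recursive2 subn.
Proof.
(* The recursion runs on the subtrahend, which therefore has to be the first argument. *)
suff r : recursive2 (fun y p => p - y) by move=> n g1 g2 r1 r2; exact: (r _ _ _ r2 r1).
apply: (@recursive2_prim id (fun y r p => r.-1)) => [||p|y p]; try solve_rec.
  exact: subn0.
exact: subnS.
Qed.
#[local] Hint Resolve recursiveB : recdb.

(** Truth values are numbers through the coercion. The sum of the two truncated differences vanishes
    exactly when the arguments agree. *)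
Lemma recursive_eq n (g1 g2 : n.-tuple nat -> nat) :
  recursive g1 -> recursive g2 -> recursive (fun v => g1 v == g2 v).
Proof.
move=> r1 r2.
apply: (@rec_ext _ (fun v => 1 - ((g1 v - g2 v) + (g2 v - g1 v)))).
  by solve_rec.
by move=> v; case: eqP; lia.
Qed.

Lemma recursive_leq n (g1 g2 : n.-tuple nat -> nat) :
  recursive g1 -> recursive g2 -> recursive (fun v => g1 v <= g2 v).
Proof. by rewrite /leq => r1 r2; apply: recursive_eq; solve_rec. Qed.

Lemma recursiveN n (b : n.-tuple nat -> bool) :
  recursive (fun v => b v) -> recursive (fun v => ~~ b v).
Proof.
move=> rb; apply: (@rec_ext _ (fun v => 1 - b v)); first by solve_rec.
by move=> v; case: (b v).
Qed.

Lemma recursive_and n (b c : n.-tuple nat -> bool) :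
  recursive (fun v => b v) -> recursive (fun v => c v) ->
  recursive (fun v => b v && c v).
Proof.
move=> rb rc; apply: (@rec_ext _ (fun v => b v * c v)); first by solve_rec.
by move=> v; case: (b v); case: (c v).
Qed.

Lemma recursive_or n (b c : n.-tuple nat -> bool) :
  recursive (fun v => b v) -> recursive (fun v => c v) ->
  recursive (fun v => b v || c v).
Proof.
move=> rb rc; apply: (@rec_ext _ (fun v => 1 - (1 - b v) * (1 - c v))).
  by solve_rec.
by move=> v; case: (b v); case: (c v).
Qed.

Lemma recursive_if n (b : n.-tuple nat -> bool) f g :
  recursive (fun v => b v) -> recursive f -> recursive g ->
  recursive (fun v => if b v then f v else g v).
Proof.
move=> rb rf rg; apply: (@rec_ext _ (fun v => b v * f v + (1 - b v) * g v)).
  by solve_rec.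
by move=> v; case: (b v); rewrite ?mul1n ?mul0n ?addn0.
Qed.

Lemma recursive_nth_nil n (r : n.-tuple nat -> nat) :
  recursive (fun v => nth 0 [::] (r v)).
Proof.
by apply: (@rec_ext _ (fun=> 0)) => [|v]; [solve_rec | rewrite nth_nil].
Qed.

(** Together with the empty list, this makes [nth] on a literal list a recursive case distinction on
    a tag. *)
Lemma recursive_nth_cons n (f r : n.-tuple nat -> nat) (l : n.-tuple nat -> seq nat) :
  recursive f -> recursive r -> recursive (fun v => nth 0 (l v) (r v).-1) ->
  recursive (fun v => nth 0 (f v :: l v) (r v)).
Proof.
move=> rf rr rl.
apply: (@rec_ext _ (fun v => if r v == 0 then f v else nth 0 (l v) (r v).-1)).
  by apply: recursive_if => //; apply: recursive_eq => //; solve_rec.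
by move=> v; case: (r v).
Qed.

#[local] Hint Resolve recursive_eq recursive_leq recursiveN recursive_and
  recursive_or recursive_if recursive_nth_nil recursive_nth_cons : recdb.

(** * Division and the inverses of the pairing *)

Lemma recursive_div d n (g : n.-tuple nat -> nat) :
  recursive g -> recursive (fun v => g v %/ d.+1).
Proof.
move: n g; change (recursive1 (fun x => x %/ d.+1)).
(* As a number the test is 0 once [d.+1 * y.+1] exceeds [p]; the least such [y] is the quotient. *)
apply: (@recursive1_min (fun y p => d.+1 * y.+1 <= p)) => [|p|p y lt].
- by solve_rec.
- by apply/eqP; rewrite eqb0 -ltnNge mulnC ltn_ceil.
- apply/eqP; rewrite eqb0 negbK mulnC.
  by rewrite -leq_divRL.
Qed.

Lemma recursive_mod d n (g : n.-tuple nat -> nat) :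
  recursive g -> recursive (fun v => g v %% d.+1).
Proof.
move=> rg; apply: (@rec_ext _ (fun v => g v - g v %/ d.+1 * d.+1)).
  have rgd := recursive_div d rg; by solve_rec.
by move=> v; rewrite {1}(divn_eq (g v) d.+1) addKn.
Qed.
#[local] Hint Resolve recursive_div recursive_mod : recdb.

Lemma recursive_tri : recursive1 tri.
Proof.
move=> n g rg; apply: (@rec_ext _ (fun v => (g v * (g v).+1) %/ 2)).
  by solve_rec.
by move=> v; rewrite divn2.
Qed.
#[local] Hint Resolve recursive_tri : recdb.

Lemma recursive_npair : recursive2 npair.
Proof. by rewrite /npair; solve_rec. Qed.
#[local] Hint Resolve recursive_npair : recdb.

Lemma tri_unbounded p : exists w, p < tri w.+1.
Proof. by exists p; apply: leq_trans (tri_ge _). Qed.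

(** The diagonal of the Cantor pairing on which [p] lies, that is, the sum of its two components. *)
Definition tri_root p := ex_minn (tri_unbounded p).
Definition unpair1 p := p - tri (tri_root p).
Definition unpair2 p := tri_root p - unpair1 p.

Lemma tri_root_npair m n : tri_root (npair m n) = m + n.
Proof.
rewrite /tri_root; case: ex_minnP => w lt /(_ (m + n)).
rewrite triS /npair ltn_add2l ltnS leq_addr => /(_ isT).
rewrite leq_eqVlt => /orP[/eqP//|/tri_le].
by move: lt; rewrite /npair; lia.
Qed.

Lemma unpair1K m n : unpair1 (npair m n) = m.
Proof. by rewrite /unpair1 tri_root_npair /npair; lia. Qed.

Lemma unpair2K m n : unpair2 (npair m n) = n.
Proof. by rewrite /unpair2 unpair1K tri_root_npair; lia. Qed.

Lemma recursive_tri_root : recursive1 tri_root.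
Proof.
apply: (@recursive1_min (fun y p => tri y.+1 <= p)) => [|p|p y].
- by solve_rec.
- by apply/eqP; rewrite eqb0 -ltnNge /tri_root; case: ex_minnP.
- rewrite /tri_root; case: ex_minnP => w _ min lt.
  by case: leqP => // /min; rewrite leqNgt lt.
Qed.
#[local] Hint Resolve recursive_tri_root : recdb.

Lemma recursive_unpair1 : recursive1 unpair1.
Proof. by rewrite /unpair1; solve_rec. Qed.
#[local] Hint Resolve recursive_unpair1 : recdb.

Lemma recursive_unpair2 : recursive1 unpair2.
Proof. by rewrite /unpair2; solve_rec. Qed.
#[local] Hint Resolve recursive_unpair2 : recdb.

(** * Course-of-values recursion *)

(* The history of [f] at [y] is the [scode] of [:: f y.-1; ...; f 0]. *)
Fixpoint history (f : nat -> nat) (y : nat) : nat :=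
  if y is y'.+1 then (npair (f y') (history f y')).+1 else 0.

Definition ctail (c : nat) : nat := unpair2 c.-1.
Definition chead (c : nat) : nat := unpair1 c.-1.
Definition lookup (y H a : nat) : nat := chead (iter (y.-1 - a) ctail H).

(** The newest value comes first, so dropping [y.-1 - a] entries leaves the history at [a.+1], whose
    head is [f a]. *)
Lemma lookup_history f y a : a < y -> lookup y (history f y) a = f a.
Proof.
move=> lt; rewrite /lookup.
have -> : iter (y.-1 - a) ctail (history f y) = history f a.+1.
  have {2}-> : y = y.-1 - a + a.+1 by lia.
  by elim: (y.-1 - a) => //= m IH; rewrite -iterS iterSr /ctail /= unpair2K.
by rewrite /chead /= unpair1K.
Qed.

Lemma recursive_lookup : recursive3 lookup.
Proof.
have rt : recursive2 (fun i H => iter i ctail H).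
  apply: (@recursive2_prim id (fun y r p => ctail r)) => //.
  by rewrite /ctail; solve_rec.
by rewrite /lookup /chead => n g1 g2 g3 r1 r2 r3; apply: recursive_unpair1;
  apply: recursive_pred; apply: rt; solve_rec.
Qed.
#[local] Hint Resolve recursive_lookup : recdb.

(** The history is primitive recursive in [y], since its next entry is [G] applied to lookups in the
    current one. Quantifying over every [phi] that agrees with [h] below [y] ensures that junk
    lookups elsewhere cannot matter. *)
Lemma recursive2_history (G : nat -> (nat -> nat) -> nat -> nat) h :
  recursive3 (fun y H p => G y (lookup y H) p) ->
  (forall y p phi, (forall a, a < y -> phi a = h a p) -> h y p = G y phi p) ->
  recursive2 h.
Proof.
move=> rG hE.
have e y p : h y p = G y (lookup y (history (h^~ p) y)) p.
  by apply: hE => a lt; rewrite lookup_history.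
have rH : recursive2 (fun y p => history (h^~ p) y).
  apply: (@recursive2_prim (fun=> 0)
            (fun y r p => (npair (G y (lookup y r) p) r).+1)) => //.
  - by solve_rec.
  - by move=> n g1 g2 g3 r1 r2 r3; have := rG _ _ _ _ r1 r2 r3; solve_rec.
  - by move=> y p /=; rewrite {1}e.
move=> n g1 g2 r1 r2.
apply: rec_ext (rG _ _ _ _ r1 (rH _ _ _ r1 r2) r2) _ => v.
by rewrite -e.
Qed.

(** Transfers the scheme to syntax: the coding is a bijection, and a structural recursion consults
    only subterms, whose codes are smaller. *)
Lemma recursive2_code (A : Type) (code : A -> nat) (dec : nat -> A)
    (G : nat -> (nat -> nat) -> nat -> nat) (h : A -> nat -> nat) :
  cancel code dec -> cancel dec code ->
  recursive3 (fun y H p => G y (lookup y H) p) ->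
  (forall x p phi, (forall z, code z < code x -> phi (code z) = h z p) ->
     h x p = G (code x) phi p) ->
  recursive2 (fun y p => h (dec y) p).
Proof.
move=> codeK decK rG hE; apply: (recursive2_history rG) => y p phi e.
by rewrite (hE _ _ phi) decK // => z lt; rewrite e // codeK.
Qed.

(** * Decoding *)

(** The preimage is merely chosen. Recursiveness of an operation on codes never rests on computing
    [decode], only on equations between codes. *)
Definition decode (A : Type) (code : A -> nat)
    (code_surj : forall n, exists x, code x = n) (n : nat) : A :=
  sval (constructive_indefinite_description _ (code_surj n)).

Lemma decodeK (A : Type) (code : A -> nat)
    (code_surj : forall n, exists x, code x = n) :
  cancel (decode code_surj) code.
Proof. by move=> n; rewrite /decode; case: constructive_indefinite_description. Qed.

Lemma codeK (A : Type) (code : A -> nat) (code_inj : injective code)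
    (code_surj : forall n, exists x, code x = n) :
  cancel code (decode code_surj).
Proof. by move=> x; apply: code_inj; rewrite decodeK. Qed.

Definition sdec := decode scode_surj.
Definition ndec := decode ncode_surj.
Definition bdec := decode bcode_surj.
Definition tdec := decode tcode_surj.
Definition ddec := decode dcode_surj.

Definition sdecK : cancel sdec scode := decodeK scode_surj.
Definition ndecK : cancel ndec ncode := decodeK ncode_surj.
Definition bdecK : cancel bdec bcode := decodeK bcode_surj.
Definition tdecK : cancel tdec tcode := decodeK tcode_surj.
Definition ddecK : cancel ddec dcode := decodeK dcode_surj.

Definition scodeK : cancel scode sdec := codeK scode_inj scode_surj.
Definition ncodeK : cancel ncode ndec := codeK ncode_inj ncode_surj.
Definition bcodeK : cancel bcode bdec := codeK bcode_inj bcode_surj.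
Definition tcodeK : cancel tcode tdec := codeK tcode_inj tcode_surj.
Definition dcodeK : cancel dcode ddec := codeK dcode_inj dcode_surj.

Lemma npair_gel m n : m <= npair m n.
Proof. by case: (npair_ge m n). Qed.

Lemma npair_ger m n : n <= npair m n.
Proof. by case: (npair_ge m n). Qed.

(** * List operations on codes *)

Lemma recursive_chead : recursive1 chead.
Proof. by rewrite /chead; solve_rec. Qed.

Lemma recursive_ctail : recursive1 ctail.
Proof. by rewrite /ctail; solve_rec. Qed.
#[local] Hint Resolve recursive_chead recursive_ctail : recdb.

Lemma chead_cons x c : chead (npair x c).+1 = x.
Proof. exact: unpair1K. Qed.

Lemma ctail_cons x c : ctail (npair x c).+1 = c.
Proof. exact: unpair2K. Qed.

(** Structural recursion on lists: [G] receives the head, the code of the tail, the value at the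
    tail and the parameter. *)
Lemma recursive2_scode (G0 : nat -> nat) (G : nat -> nat -> nat -> nat -> nat)
    (h : seq nat -> nat -> nat) :
  recursive1 G0 ->
  recursive3 (fun y r p => G (chead y) (ctail y) r p) ->
  (forall p, h [::] p = G0 p) ->
  (forall x s p, h (x :: s) p = G x (scode s) (h s p) p) ->
  recursive2 (fun y p => h (sdec y) p).
Proof.
move=> rG0 rG h0 hS.
pose F y (phi : nat -> nat) p :=
  if y == 0 then G0 p else G (chead y) (ctail y) (phi (ctail y)) p.
apply: (@recursive2_code _ _ _ F) scodeK sdecK _ _ => [n g1 g2 g3 r1 r2 r3|].
  apply: recursive_if; [solve_rec | exact: rG0 |].
  by apply: (rG _ g1 (fun v => lookup (g1 v) (g2 v) (ctail (g1 v))) g3);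
    solve_rec.
case=> [|x s] p phi e; rewrite /F /= ?h0 // chead_cons ctail_cons hS e //=.
by rewrite ltnS npair_ger.
Qed.

(** The recursion passes earlier truth values as numbers; [r != 0] reads them back. *)
Lemma nat_of_bool_neq0 (b : bool) : ((b : nat) != 0) = b.
Proof. by case: b. Qed.

Definition csize y := size (sdec y).
Definition cmem y x := x \in sdec y.
Definition cuniq y := uniq (sdec y).
Definition csubset y z := all (mem (sdec z)) (sdec y).
Definition ccat y z := scode (sdec y ++ sdec z).
Definition cremove y x := scode [seq z <- sdec y | z != x].

Lemma recursive_csize : recursive1 csize.
Proof.
suff r : recursive2 (fun y _ => csize y) by move=> n g rg; exact: (r _ _ _ rg rg).
by apply: (@recursive2_scode (fun=> 0) (fun x s r p => r.+1)
  (fun s _ => size s)) => //; solve_rec.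
Qed.

Lemma recursive_cmem n (g1 g2 : n.-tuple nat -> nat) :
  recursive g1 -> recursive g2 -> recursive (fun v => cmem (g1 v) (g2 v)).
Proof.
move: n g1 g2; change (recursive2 cmem).
apply: (@recursive2_scode (fun=> 0) (fun x s r p => (p == x) || (r != 0))
  (fun s x => x \in s)) => //; try solve_rec.
by move=> x s p; rewrite inE nat_of_bool_neq0.
Qed.
#[local] Hint Resolve recursive_csize recursive_cmem : recdb.

Lemma recursive_cuniq n (g : n.-tuple nat -> nat) :
  recursive g -> recursive (fun v => cuniq (g v)).
Proof.
suff r : recursive2 (fun y _ => cuniq y) by move=> rg; exact: (r _ _ _ rg rg).
apply: (@recursive2_scode (fun=> 1) (fun x s r p => ~~ cmem s x && (r != 0))
  (fun s _ => uniq s)) => //; try solve_rec.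
by move=> x s p /=; rewrite nat_of_bool_neq0 /cmem scodeK.
Qed.

Lemma recursive_csubset n (g1 g2 : n.-tuple nat -> nat) :
  recursive g1 -> recursive g2 -> recursive (fun v => csubset (g1 v) (g2 v)).
Proof.
move: n g1 g2; change (recursive2 csubset).
apply: (@recursive2_scode (fun=> 1) (fun x s r p => cmem p x && (r != 0))
  (fun s p => all (mem (sdec p)) s)) => //; try solve_rec.
by move=> x s p /=; rewrite nat_of_bool_neq0.
Qed.

Lemma recursive_ccat : recursive2 ccat.
Proof.
apply: (@recursive2_scode id (fun x s r p => (npair x r).+1)
  (fun s p => scode (s ++ sdec p))) => //; try solve_rec.
by move=> p; rewrite /= sdecK.
Qed.

Lemma recursive_cremove : recursive2 cremove.
Proof.
apply: (@recursive2_scode (fun=> 0)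
  (fun x s r p => if x != p then (npair x r).+1 else r)
  (fun s x => scode [seq z <- s | z != x])) => //; try solve_rec.
by move=> x s p /=; case: ifP.
Qed.
#[local] Hint Resolve recursive_cuniq recursive_csubset recursive_ccat
  recursive_cremove : recdb.

Lemma ccat_scode s t : ccat (scode s) (scode t) = scode (s ++ t).
Proof. by rewrite /ccat !scodeK. Qed.

Lemma cremove_scode s x : cremove (scode s) x = scode [seq z <- s | z != x].
Proof. by rewrite /cremove scodeK. Qed.

(** * Free variables, names and substitution on codes *)

Definition unpairK := (unpair1K, unpair2K).

Lemma tag5E q :
  (((5 * q) %/ 5 = q) * ((5 * q) %% 5 = 0) *
   ((5 * q + 1) %/ 5 = q) * ((5 * q + 1) %% 5 = 1) *
   ((5 * q + 2) %/ 5 = q) * ((5 * q + 2) %% 5 = 2) *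
   ((5 * q + 3) %/ 5 = q) * ((5 * q + 3) %% 5 = 3) *
   ((5 * q + 4) %/ 5 = q) * ((5 * q + 4) %% 5 = 4))%type.
Proof. by do ! split; lia. Qed.

Lemma tag4E q :
  (((4 * q) %/ 4 = q) * ((4 * q) %% 4 = 0) *
   ((4 * q + 1) %/ 4 = q) * ((4 * q + 1) %% 4 = 1) *
   ((4 * q + 2) %/ 4 = q) * ((4 * q + 2) %% 4 = 2) *
   ((4 * q + 3) %/ 4 = q) * ((4 * q + 3) %% 4 = 3))%type.
Proof. by do ! split; lia. Qed.

(** [Nil] has code 0 and the other tags run from 1 to 7, so the predecessor is taken before
    dividing. *)
Lemma tag7E q :
  (((7 * q + 1).-1 %/ 7 = q) * ((7 * q + 1).-1 %% 7 = 0) *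
   ((7 * q + 2).-1 %/ 7 = q) * ((7 * q + 2).-1 %% 7 = 1) *
   ((7 * q + 3).-1 %/ 7 = q) * ((7 * q + 3).-1 %% 7 = 2) *
   ((7 * q + 4).-1 %/ 7 = q) * ((7 * q + 4).-1 %% 7 = 3) *
   ((7 * q + 5).-1 %/ 7 = q) * ((7 * q + 5).-1 %% 7 = 4) *
   ((7 * q + 6).-1 %/ 7 = q) * ((7 * q + 6).-1 %% 7 = 5) *
   ((7 * q + 7).-1 %/ 7 = q) * ((7 * q + 7).-1 %% 7 = 6))%type.
Proof. by do ! split; lia. Qed.

(* The second argument of the three substitutions is [npair x n] for {n/x}. *)
Definition cnfv y := scode (nfv (ndec y)).
Definition cnsubst y p := ncode (nsubst (unpair1 p) (unpair2 p) (ndec y)).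
Definition cbfv y := scode (bfv (bdec y)).
Definition cbsubst y p := bcode (bsubst (unpair1 p) (unpair2 p) (bdec y)).
Definition cfv y := scode (fv (tdec y)).
Definition cglobal_names y := scode (global_names (tdec y)).
Definition clocal_count y := local_count (tdec y).
Definition csubst y p := tcode (subst (unpair1 p) (unpair2 p) (tdec y)).

(** Shows that codes of subterms are smaller: a pair is only known to bound both components, and the
    rest is linear. *)
Ltac npair_lia :=
  repeat match goal with
  | |- context [npair ?a ?b] =>
      have := npair_gel a b; have := npair_ger a b; move: (npair a b) => ?
  end; lia.

(** The pattern for all syntax operations: the remainder of the code selects the clause of the
    constructor from a table, and the quotient holds the codes of its arguments. Entries for other
    constructors read meaningless subcodes, but [nth] discards them. *)
Lemma recursive_cnfv : recursive1 cnfv.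
Proof.
suff r : recursive2 (fun y _ => cnfv y) by move=> n g rg; exact: (r _ _ _ rg rg).
pose G y (phi : nat -> nat) (p : nat) :=
  let q := y %/ 5 in
  nth 0 [:: (npair q 0).+1; 0; phi q;
            ccat (phi (unpair1 q)) (phi (unpair2 q));
            ccat (phi (unpair1 q)) (phi (unpair2 q))] (y %% 5).
apply: (@recursive2_code _ _ _ G (fun t _ => scode (nfv t))) ncodeK ndecK _ _.
  by rewrite /G; solve_rec.
by case=> [x|n|t|t u|t u] p phi e;
  rewrite /G /= !tag5E ?unpairK //= !e ?ccat_scode //=; npair_lia.
Qed.

Lemma recursive_cnsubst : recursive2 cnsubst.
Proof.
pose G y (phi : nat -> nat) p :=
  let q := y %/ 5 in
  nth 0 [:: if q == unpair1 p then 5 * unpair2 p + 1 else y; y; 5 * phi q + 2;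
            5 * npair (phi (unpair1 q)) (phi (unpair2 q)) + 3;
            5 * npair (phi (unpair1 q)) (phi (unpair2 q)) + 4] (y %% 5).
apply: (@recursive2_code _ _ _ G
  (fun t p => ncode (nsubst (unpair1 p) (unpair2 p) t))) ncodeK ndecK _ _.
  by rewrite /G; solve_rec.
case=> [x|n|t|t u|t u] p phi e; rewrite /G /= !tag5E ?unpairK //= ?e //=;
  try npair_lia.
by case: eqP.
Qed.
#[local] Hint Resolve recursive_cnfv recursive_cnsubst : recdb.

Lemma recursive_cbfv : recursive1 cbfv.
Proof.
suff r : recursive2 (fun y _ => cbfv y) by move=> n g rg; exact: (r _ _ _ rg rg).
pose G y (phi : nat -> nat) (p : nat) :=
  let q := y %/ 4 in
  nth 0 [:: ccat (cnfv (unpair1 q)) (cnfv (unpair2 q));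
            ccat (cnfv (unpair1 q)) (cnfv (unpair2 q)); phi q;
            ccat (phi (unpair1 q)) (phi (unpair2 q))] (y %% 4).
apply: (@recursive2_code _ _ _ G (fun b _ => scode (bfv b))) bcodeK bdecK _ _.
  by rewrite /G; solve_rec.
by case=> [t u|t u|b|b c] p phi e; rewrite /G /= !tag4E ?unpairK //= ?e
  /cnfv ?ncodeK ?ccat_scode //=; npair_lia.
Qed.

Lemma recursive_cbsubst : recursive2 cbsubst.
Proof.
pose G y (phi : nat -> nat) p :=
  let q := y %/ 4 in
  nth 0 [:: 4 * npair (cnsubst (unpair1 q) p) (cnsubst (unpair2 q) p);
            4 * npair (cnsubst (unpair1 q) p) (cnsubst (unpair2 q) p) + 1;
            4 * phi q + 2;
            4 * npair (phi (unpair1 q)) (phi (unpair2 q)) + 3] (y %% 4).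
apply: (@recursive2_code _ _ _ G
  (fun b p => bcode (bsubst (unpair1 p) (unpair2 p) b))) bcodeK bdecK _ _.
  by rewrite /G; solve_rec.
by case=> [t u|t u|b|b c] p phi e; rewrite /G /= !tag4E ?unpairK //= ?e
  /cnsubst ?ncodeK //=; npair_lia.
Qed.
#[local] Hint Resolve recursive_cbfv recursive_cbsubst : recdb.

Lemma recursive_cfv : recursive1 cfv.
Proof.
suff r : recursive2 (fun y _ => cfv y) by move=> n g rg; exact: (r _ _ _ rg rg).
pose G y (phi : nat -> nat) (p : nat) :=
  (* For prefixes [x] is the bound variable or the code of the sent expression, and [c] the code of
     the continuation; the other constructors use the components [a] and [b]. *)
  let q := y.-1 %/ 7 in let a := unpair1 q in let b := unpair2 q in
  let x := unpair1 b in let c := unpair2 b in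
  if y == 0 then 0 else
  nth 0 [:: cremove (phi c) x; ccat (cnfv x) (phi c); ccat (phi a) (phi b);
            phi b; ccat (cbfv a) (phi b); cremove (phi c) x;
            ccat (cnfv x) (phi c)] (y.-1 %% 7).
apply: (@recursive2_code _ _ _ G (fun T _ => scode (fv T))) tcodeK tdecK _ _.
  by rewrite /G; solve_rec.
by case=> [|a x T|a t T|S T|c T|b T|a x T|a t T] p phi e;
  rewrite /G /= ?addn_eq0 ?andbF ?tag7E ?unpairK //= !e /cnfv /cbfv
    ?ncodeK ?bcodeK ?ccat_scode ?cremove_scode //=; npair_lia.
Qed.

Lemma recursive_cglobal_names : recursive1 cglobal_names.
Proof.
suff r : recursive2 (fun y _ => cglobal_names y).
  by move=> n g rg; exact: (r _ _ _ rg rg).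
pose G y (phi : nat -> nat) (p : nat) :=
  let q := y.-1 %/ 7 in let a := unpair1 q in let b := unpair2 q in
  let c := unpair2 b in
  if y == 0 then 0 else
  nth 0 [:: (npair a (phi c)).+1; (npair a (phi c)).+1; ccat (phi a) (phi b);
            cremove (phi b) a; phi b; (npair a (phi c)).+1;
            (npair a (phi c)).+1] (y.-1 %% 7).
apply: (@recursive2_code _ _ _ G (fun T _ => scode (global_names T)))
  tcodeK tdecK _ _.
  by rewrite /G; solve_rec.
by case=> [|a x T|a t T|S T|c T|b T|a x T|a t T] p phi e;
  rewrite /G /= ?addn_eq0 ?andbF ?tag7E ?unpairK //= !e
    ?ccat_scode ?cremove_scode //=; npair_lia.
Qed.

Lemma recursive_clocal_count : recursive1 clocal_count.
Proof.
suff r : recursive2 (fun y _ => clocal_count y).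
  by move=> n g rg; exact: (r _ _ _ rg rg).
pose G y (phi : nat -> nat) (p : nat) :=
  let q := y.-1 %/ 7 in let a := unpair1 q in let b := unpair2 q in
  let c := unpair2 b in
  if y == 0 then 0 else
  nth 0 [:: phi c; phi c; phi a + phi b; (phi b).+1; phi b; phi c; phi c]
    (y.-1 %% 7).
apply: (@recursive2_code _ _ _ G (fun T _ => local_count T)) tcodeK tdecK _ _.
  by rewrite /G; solve_rec.
by case=> [|a x T|a t T|S T|c T|b T|a x T|a t T] p phi e;
  rewrite /G /= ?addn_eq0 ?andbF ?tag7E ?unpairK //= !e //=; npair_lia.
Qed.

Lemma recursive_csubst : recursive2 csubst.
Proof.
pose G y (phi : nat -> nat) p :=
  let q := y.-1 %/ 7 in let a := unpair1 q in let b := unpair2 q in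
  let x := unpair1 b in let c := unpair2 b in
  (* A binder of the substituted variable shields its body. *)
  let c' := if x == unpair1 p then c else phi c in
  if y == 0 then 0 else
  nth 0 [:: 7 * npair a (npair x c') + 1;
            7 * npair a (npair (cnsubst x p) (phi c)) + 2;
            7 * npair (phi a) (phi b) + 3; 7 * npair a (phi b) + 4;
            7 * npair (cbsubst a p) (phi b) + 5; 7 * npair a (npair x c') + 6;
            7 * npair a (npair (cnsubst x p) (phi c)) + 7] (y.-1 %% 7).
apply: (@recursive2_code _ _ _ G
  (fun T p => tcode (subst (unpair1 p) (unpair2 p) T))) tcodeK tdecK _ _.
  by rewrite /G; solve_rec.
by case=> [|a x T|a t T|S T|c T|b T|a x T|a t T] p phi e;
  rewrite /G /= ?addn_eq0 ?andbF ?tag7E ?unpairK //= ?e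
    /cnsubst /cbsubst ?ncodeK ?bcodeK ?(fun_if tcode) //=; npair_lia.
Qed.
#[local] Hint Resolve recursive_cfv recursive_cglobal_names
  recursive_clocal_count recursive_csubst : recdb.

(** * Type checking and instantiation on indices *)

Definition well_typed (i : nat) (js : seq name) (k : nat) (D : pdef) : bool :=
  [&& size (params D) == k, uniq (params D),
      all (mem (params D)) (fv (body D)), local_count (body D) == i,
      all (mem js) (global_names (body D)) & all (mem (global_names (body D))) js].

Lemma well_typedP i js k D :
  reflect (kary k D /\ has_type i js D) (well_typed i js k D).
Proof.
apply: (iffP idP).
  move=> /and5P[/eqP e1 e2 /allP e3 /eqP e4 /andP[/allP e5 /allP e6]].
  by split; split=> // a; apply/idP/idP; [apply: e5 | apply: e6].
move=> [[e1 e2 e3] [e4 e5]]; apply/and5P; split=> //; try exact/eqP.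
  exact/allP.
by apply/andP; split; apply/allP => a; rewrite /= e5.
Qed.

(** A number that codes no definition of the type is an index of the inert one; after this
    replacement, plain decoding yields the indexed definition. *)
Definition normal_index i js k j : nat :=
  if well_typed i js k (ddec j) then j else dcode (inert i js k).

Lemma has_index_normal i js k j :
  has_index i js k j (ddec (normal_index i js k j)).
Proof.
rewrite /normal_index; case: well_typedP => [[kD tD]|nD].
  by left; rewrite ddecK.
right; rewrite dcodeK; split=> // D' kD' tD' e; apply: nD.
by rewrite -e dcodeK.
Qed.

Lemma ddecE j : ddec j = PDef (sdec (unpair1 j)) (tdec (unpair2 j)).
Proof.
have [zs T] := dcode_surj j; case: zs T => zs T <-.
by rewrite dcodeK /dcode unpair1K unpair2K scodeK tcodeK.
Qed.

Lemma recursive_normal_index i js k : recursive1 (normal_index i js k).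
Proof.
move=> n g rg; apply: recursive_if => //; last exact: recursive_const.
(* The test [well_typed] carried out on the codes of the parameter list and of the body. *)
pose w y :=
  [&& csize (unpair1 y) == k, cuniq (unpair1 y),
      csubset (cfv (unpair2 y)) (unpair1 y), clocal_count (unpair2 y) == i,
      csubset (cglobal_names (unpair2 y)) (scode js)
    & csubset (scode js) (cglobal_names (unpair2 y))].
apply: (@rec_ext _ (fun v => w (g v))); first by rewrite /w; solve_rec.
move=> v; rewrite /w /well_typed ddecE /=.
by rewrite /csubset /cfv /cglobal_names !scodeK.
Qed.

Lemma recursive_inst1 : recursive2 (fun y m => dcode (inst (ddec y) [:: m])).
Proof.
(* Code 0 is the empty parameter list, where instantiation changes nothing. *)
pose F y m := if unpair1 y == 0 then y else
  npair (ctail (unpair1 y)) (csubst (unpair2 y) (npair (chead (unpair1 y)) m)).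
have rF : recursive2 F by rewrite /F; solve_rec.
move=> n g1 g2 r1 r2; apply: rec_ext (rF _ _ _ r1 r2) _ => v; rewrite /F.
have [[zs T] <-] := dcode_surj (g1 v).
rewrite dcodeK /dcode unpair1K unpair2K; case: zs => [|z zs] //=.
by rewrite ctail_cons chead_cons /csubst !unpairK tcodeK /inst /=; case: zs.
Qed.

(** The numbers are instantiated one at a time, by induction on the list of functions that compute
    them. The hypothesis covers every position, default included, so it passes to the tail by a
    shift. *)
Lemma recursive_inst n (g : n.-tuple nat -> nat)
    (gs : seq (n.-tuple nat -> nat)) :
  recursive g -> (forall m, recursive (nth (fun=> 0) gs m)) ->
  recursive (fun v => dcode (inst (ddec (g v)) [seq f v | f <- gs])).
Proof.
elim: gs g => [|f gs IH] g rg rgs.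
  apply: rec_ext rg _ => v.
  by rewrite -[LHS]ddecK; case: (ddec (g v)) => -[].
apply: rec_ext (IH _ (recursive_inst1 rg (rgs 0)) (fun m => rgs m.+1)) _ => v.
by rewrite /= dcodeK inst_cat.
Qed.

(** * The index function and its two sides compared *)

Theorem theorem5p1 (i : nat) (js : seq name) (U : nat -> pdef)
    (universalU : forall k, universal i js k (U k)) (k0 k1 : nat) :
  exists s : k0.+1.-tuple nat -> nat,
    recursive s /\
    forall (j : nat) (ns : k0.-tuple nat),
      pdef_eq k1 (inst (inst (U (k0 + k1)) [:: j]) ns)
                 (inst (U k1) [:: s (cons_tuple j ns)]).
Proof.
pose D j := ddec (normal_index i js (k0 + k1) j).
exists (fun v => dcode (inst (D (thead v)) (behead v))); split.
  (* Position 0 of the argument holds [j], so the numbers to be instantiated are the projections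
     from position 1 on. *)
  pose gs := mkseq (fun m (v : k0.+1.-tuple nat) => nth 0 v m.+1) k0.
  have r0 : recursive (fun v : k0.+1.-tuple nat => thead v).
    exact: (rec_proj ord0).
  have rgs m : recursive (nth (fun=> 0) gs m).
    have [lt|ge] := ltnP m k0; last first.
      by rewrite nth_default ?size_mkseq //; apply: rec_zero.
    rewrite nth_mkseq //.
    apply: rec_ext (rec_proj (Ordinal (lt : m.+1 < k0.+1))) _ => v.
    by rewrite (tnth_nth 0).
  apply: rec_ext (recursive_inst (recursive_normal_index i js (k0 + k1) r0) rgs) _.
  move=> v; congr (dcode (inst _ _)); rewrite -map_comp.
  case/tupleP: v => x v /=; transitivity (mkseq (nth 0 v) (size v)).
    by rewrite [in RHS]size_tuple; apply: eq_map.
  exact: mkseq_nth.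
move=> j ns ms /=; rewrite theadE.
have hD : has_index i js (k0 + k1) j (D j) := has_index_normal i js (k0 + k1) j.
have [kD tD] := has_index_typed hD.
(* Instantiation keeps the type and lowers the arity to [k1], so the instance has its own code as an
   index. *)
have hD' : has_index i js k1 (dcode (inst (D j) ns)) (inst (D j) ns).
  by left; split=> //; [apply: inst_kary | apply: inst_has_type].
have [_ /(_ _ _ hD (cat_tuple ns ms))/= e] := universalU (k0 + k1).
have [_ /(_ _ _ hD' ms) e'] := universalU k1.
(* By universality, both sides equal [D j] instantiated at [ns] followed by [ms]. *)
apply: abs_eq_trans (abs_eq_sym e').
by rewrite !inst_cat in e *.
Qed.
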